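(* Let $G$ be a graph of order $n$ and maximum degree $\Delta(G)=1$. Then $\mathcal{A}(G)\le \mathcal{A}\big(\lfloor n/2\rfloor K_2\cup (n \bmod 2)K_1\big)$, with equality if and only if $G$ is isomorphic to $\lfloor n/2\rfloor K_2\cup (n\bmod 2)K_1$.
   Context: Graphs are finite and simple. For a graph $G$ of order $n$ and an integer $k$, $S(G,k)$ denotes the number of partitions of $V(G)$ into exactly $k$ nonempty stable sets (non-equivalent colorings with exactly $k$ colors). Let $\mathcal{B}(G)=\sum_{k=1}^n S(G,k)$, $\mathcal{T}(G)=\sum_{k=1}^n kS(G,k)$, and $\mathcal{A}(G)=\mathcal{T}(G)/\mathcal{B}(G)$. $G\cup H$ denotes disjoint union, $pH$ the disjoint union of $p$ copies of $H$ ($0H$ is the empty graph on no vertices), and $K_m$ the complete graph on $m$ vertices. *)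

(* Defs.v *)
From mathcomp Require Import all_boot all_order all_algebra.

Set Implicit Arguments.
Unset Strict Implicit.
Unset Printing Implicit Defensive.

Record sgraph := SGraph {
  vertex :> finType;
  adj : rel vertex;
  adj_sym : symmetric adj;
  adj_irr : irreflexive adj
}.

Definition degree (G : sgraph) (x : G) : nat := #|[set y : G | adj x y]|.

Definition max_degree (G : sgraph) : nat := \max_(x : G) degree x.

Definition stable (G : sgraph) (A : {set G}) : bool :=
  [forall x in A, forall y in A, ~~ adj x y].

(* [partition] excludes empty blocks. *)
Definition stable_partitions (G : sgraph) (k : nat) : {set {set {set G}}} :=
  [set P : {set {set G}} |
    [&& partition P [set: G], [forall A in P, stable A] & #|P| == k]].

Definition nb_colorings (G : sgraph) (k : nat) : nat :=
  #|stable_partitions G k|.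

Definition calB (G : sgraph) : nat :=
  \sum_(1 <= k < #|G|.+1) nb_colorings G k.

Definition calT (G : sgraph) : nat :=
  \sum_(1 <= k < #|G|.+1) k * nb_colorings G k.

Definition calA (G : sgraph) : rat := ((calT G)%:R / (calB G)%:R)%R.

Section Complete.
Variable m : nat.

Definition complete_adj : rel 'I_m := fun i j => i != j.

Lemma complete_adj_sym : symmetric complete_adj.
Proof. by move=> i j; rewrite /complete_adj eq_sym. Qed.

Lemma complete_adj_irr : irreflexive complete_adj.
Proof. by move=> i; rewrite /complete_adj eqxx. Qed.

Definition complete_graph : sgraph := SGraph complete_adj_sym complete_adj_irr.
End Complete.

Section DisjointUnion.
Variables G H : sgraph.

Definition dunion_adj : rel (G + H)%type := fun u v =>
  match u, v with
  | inl x, inl y => adj x y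
  | inr x, inr y => adj x y
  | _, _ => false
  end.

Lemma dunion_adj_sym : symmetric dunion_adj.
Proof. by case=> x [] y //=; apply: adj_sym. Qed.

Lemma dunion_adj_irr : irreflexive dunion_adj.
Proof. by case=> x /=; apply: adj_irr. Qed.

Definition dunion : sgraph := SGraph dunion_adj_sym dunion_adj_irr.
End DisjointUnion.

Section Copies.
Variables (p : nat) (H : sgraph).

Definition copies_adj : rel ('I_p * H)%type := fun u v =>
  (u.1 == v.1) && adj u.2 v.2.

Lemma copies_adj_sym : symmetric copies_adj.
Proof. by move=> u v; rewrite /copies_adj eq_sym adj_sym. Qed.

Lemma copies_adj_irr : irreflexive copies_adj.
Proof. by move=> u; rewrite /copies_adj adj_irr andbF. Qed.

Definition copies : sgraph := SGraph copies_adj_sym copies_adj_irr.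
End Copies.

Definition isomorphic (G H : sgraph) : Prop :=
  exists2 f : G -> H, bijective f & forall x y : G, adj (f x) (f y) = adj x y.

(* Main.v *)
(** Joining two isolated vertices [u], [v] of any graph by an edge strictly
    increases the average [calA]: the stable partitions of [G] and of [G + uv]
    are obtained from those of [G - u] by inserting [u] into a block (one not
    containing [v], for [G + uv]) or as a new block, and after this reduction
    the inequality is Cauchy-Schwarz for the number of blocks.  Starting from a
    graph of maximum degree 1, such edges can be added until at most one
    isolated vertex is left, at which point the graph is the claimed one. *)

Require Import Defs.
From mathcomp Require Import all_boot all_order all_algebra.
From mathcomp Require Import zify.

Set Implicit Arguments.
Unset Strict Implicit.
Unset Printing Implicit Defensive.

Import Order.TTheory GRing.Theory Num.Theory.

(** * Removal and insertion of one point in a set partition *)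

Section PointRemoval.
Variables (T : finType) (u : T).

(* Taking [A := set0] inserts [u] as a new singleton block. *)
Definition insert_point (QA : {set {set T}} * {set T}) : {set {set T}} :=
  (u |: QA.2) |: (QA.1 :\ QA.2).

(** The second component records where [u] came from, with [set0] standing for a singleton block. In
    that case what is left of the block is empty, and [:\ set0] discards it. *)
Definition remove_point (P : {set {set T}}) : {set {set T}} * {set T} :=
  let A := pblock P u :\ u in ((A |: (P :\ pblock P u)) :\ set0, A).

Lemma partition_setD0 (P : {set {set T}}) (D : {set T}) :
  partition P D -> P :\ set0 = P.
Proof.
move=> PD; apply/setP=> B; rewrite in_setD1.
by case: eqVneq => // ->; rewrite (partition0 PD).
Qed.

Lemma remove_point_partition (P : {set {set T}}) (D : {set T}) :
  partition P D -> u \in D ->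
  [/\ partition (remove_point P).1 (D :\ u),
      (remove_point P).2 \in set0 |: (remove_point P).1
    & insert_point (remove_point P) = P].
Proof.
move=> PD uD; have covP := cover_partition PD.
have BP : pblock P u \in P by rewrite pblock_mem ?covP.
have uB : u \in pblock P u by rewrite mem_pblock covP.
rewrite /remove_point /insert_point /=; set B := pblock P u in BP uB *.
have PD1 := partitionD1 PD BP.
rewrite (setD1K uB).
(* Either [u] formed a block by itself, which disappears, or its block survives without [u]. *)
have [A0|An0] := eqVneq (B :\ u) set0.
  have B1 : B = [set u] by rewrite -(setD1K uB) A0 setU0.
  rewrite A0 setU1K; last by rewrite (partition0 PD1).
  rewrite setU11 (partition_setD0 PD1) setD1K //; split=> //.
  by rewrite -[in D :\ u]B1.
have dAD : [disjoint B :\ u & D :\: B].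
  by rewrite -setI_eq0; apply/eqP/setP=> x; rewrite !inE; case: (x \in B); rewrite ?andbF.
have PQ := partitionU1 PD1 An0 dAD.
rewrite (partition_setD0 PQ) setU1K ?setD1K //.
  split=> //; last by rewrite !inE eqxx orbT.
  congr (partition _ _): PQ.
  apply/setP=> x; rewrite !inE.
  have := subsetP (partitionS PD BP) x.
  case: (eqVneq x u) => [->|_] /=; first by rewrite uB.
  by case: (x \in B) => //= ->.
apply/negP=> /(partitionS PD1) /subsetP sA.
case/set0Pn: An0 => x xA; have := sA x xA.
by move: xA; rewrite !inE => /andP[_ ->].
Qed.

(** Together with [remove_point_partition], this makes insertion and removal mutually inverse:
    partitions of a set containing [u] correspond to partitions of the rest with a marked block or
    [set0]. *)
Lemma insert_point_partition (Q : {set {set T}}) (D A : {set T}) :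
  partition Q D -> u \notin D -> A \in set0 |: Q ->
  [/\ partition (insert_point (Q, A)) (u |: D),
      pblock (insert_point (Q, A)) u = u |: A,
      remove_point (insert_point (Q, A)) = (Q, A)
    & #|insert_point (Q, A)| = #|Q| + (A == set0)].
Proof.
move=> QD uD AQ.
have sAD : A \subset D.
  by case/setU1P: AQ => [->|/(partitionS QD)//]; rewrite sub0set.
have uA : u \notin A by apply: contra uD; apply: (subsetP sAD).
have QD1 : partition (Q :\ A) (D :\: A).
  case/setU1P: AQ => [->|/(partitionD1 QD)//].
  by rewrite (partition_setD0 QD) setD0.
have Bn0 : u |: A != set0 by apply/set0Pn; exists u; rewrite setU11.
have dBD : [disjoint u |: A & D :\: A].
  rewrite -setI_eq0; apply/eqP/setP=> x; rewrite !inE.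
  by case: (eqVneq x u) => [->|_] /=; [rewrite (negPf uD) andbF | case: (x \in A)].
have PD := partitionU1 QD1 Bn0 dBD.
have BnQ : u |: A \notin Q :\ A.
  apply/negP=> /setD1P[_ /(partitionS QD)/subsetP/(_ u)].
  by rewrite setU11 (negPf uD) => /(_ isT).
have pbu : pblock (insert_point (Q, A)) u = u |: A.
  by apply: (def_pblock (partition_trivIset PD)); rewrite setU11.
split=> //.
- congr (partition _ _): PD; apply/setP=> x; rewrite !inE.
  by have := subsetP sAD x; case: (x \in A) => [->|_]; rewrite ?orbT ?orbF.
- rewrite /remove_point pbu /insert_point /= !setU1K //.
  congr pair; case/setU1P: AQ => [->|AQ].
    by rewrite setU1K ?inE ?eqxx // (partition_setD0 QD).
  by rewrite setD1K // (partition_setD0 QD).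
rewrite cardsU1 BnQ; case/setU1P: AQ => [->|AQ].
  by rewrite (partition_setD0 QD) eqxx addnC.
by rewrite (negPf (partition_neq0 QD AQ)) (cardsD1 A Q) AQ addn0.
Qed.

End PointRemoval.

(** * Stable partitions in the presence of an isolated vertex *)

Section Isolated.
Variable G : sgraph.

Definition stable_parts (D : {set G}) : {set {set {set G}}} :=
  [set P | partition P D & [forall A in P, stable A]].

Definition isolated (x : G) : bool := [forall y, ~~ adj x y].

Lemma stableP (A : {set G}) :
  reflect {in A &, forall x y, ~~ adj x y} (stable A).
Proof.
apply: (iffP forall_inP) => [h x y xA yA|h x xA].
  by have /forall_inP := h x xA; apply.
by apply/forall_inP=> y; apply: h.
Qed.

Lemma stableU1_isolated (u : G) (A : {set G}) :
  isolated u -> stable (u |: A) = stable A.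
Proof.
move=> /forallP iu; apply/stableP/stableP=> h x y.
  by move=> xA yA; apply: h; rewrite setU1r.
case/setU1P=> [->|xA] /setU1P[->|yA]; rewrite ?iu //; last exact: h.
by rewrite adj_sym iu.
Qed.

(** The sum is reindexed along insertion of [u], which preserves stability since [u] is isolated.
    The predicate [C] on the block of [u] lets one identity serve both [G] and [G] with an edge
    [uv], where that block must avoid [v]. *)
Lemma sum_stable_parts_insert (u : G) (C : pred {set G}) (f : nat -> nat) :
  isolated u ->
  \sum_(P in stable_parts [set: G] | C (pblock P u)) f #|P| =
  \sum_(Q in stable_parts [set~ u])
    \sum_(A in set0 |: Q | C (u |: A)) f (#|Q| + (A == set0)).
Proof.
move=> iu; rewrite pair_big_dep /=.
have uD : u \notin [set~ u] by rewrite !inE eqxx.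
have DT : u |: [set~ u] = [set: G].
  by apply/setP=> x; rewrite !inE; case: eqP.
have TD : [set: G] :\ u = [set~ u] by rewrite setTD.
have stI Q A : A \in set0 |: Q ->
    [forall B in insert_point u (Q, A), stable B] = [forall B in Q, stable B].
  move=> AQ; apply/forall_inP/forall_inP=> h B.
    move=> BQ; have [->|nBA] := eqVneq B A.
      by rewrite -(stableU1_isolated _ iu); apply: h; rewrite setU11.
    by apply: h; rewrite !inE nBA BQ orbT.
  case/setU1P=> [->|/setD1P[_ /h//]]; rewrite /= stableU1_isolated //.
  case/setU1P: AQ => [->|/h//]; apply/stableP=> x y; by rewrite inE.
rewrite (reindex_onto (@insert_point _ u) (@remove_point _ u)); last first.
  move=> P /andP[]; rewrite inE => /andP[PT _] _.
  by have [] := remove_point_partition PT (in_setT u).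
apply: eq_big => [[Q A]|[Q A]] /=; last first.
  case/andP=> /andP[]; rewrite inE => /andP[PT _] _ /eqP E.
  have [] := remove_point_partition PT (in_setT u); rewrite E TD /= => QD AQ _.
  by have [_ _ _ ->] := insert_point_partition QD uD AQ.
apply/idP/idP.
  case/andP=> /andP[]; rewrite inE => /andP[PT st] CA /eqP E.
  have [] := remove_point_partition PT (in_setT u); rewrite E TD /= => QD AQ _.
  have [_ pbu _ _] := insert_point_partition QD uD AQ.
  by rewrite inE QD -(stI _ _ AQ) st AQ -pbu.
rewrite inE; case/andP=> /andP[QD st] /andP[AQ CA].
have [PD pbu -> _] := insert_point_partition QD uD AQ.
by rewrite inE -DT PD (stI _ _ AQ) st pbu CA eqxx.
Qed.

End Isolated.

(** * Colorings counted as sums over stable partitions *)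

Lemma card_partition_leq (T : finType) (P : {set {set T}}) (D : {set T}) :
  partition P D -> #|P| <= #|D|.
Proof.
move=> PD; rewrite (card_partition PD) -sum1_card leq_sum // => A AP.
by rewrite card_gt0 (partition_neq0 PD AP).
Qed.

Lemma card_partition_gt0 (T : finType) (P : {set {set T}}) (D : {set T}) x :
  partition P D -> x \in D -> 0 < #|P|.
Proof.
move=> PD xD; rewrite card_gt0; apply/set0Pn; exists (pblock P x).
by rewrite pblock_mem // (cover_partition PD).
Qed.

(** Stable partitions are grouped by their number of blocks. The vertex [x] excludes the partition
    with no block, which the range starting at 1 would miss. *)
Lemma sum_stable_parts (G : sgraph) (x : G) (f : nat -> nat) :
  \sum_(1 <= k < #|G|.+1) f k * nb_colorings G k =
  \sum_(P in stable_parts [set: G]) f #|P|.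
Proof.
transitivity (\sum_(1 <= k < #|G|.+1)
    \sum_(P in stable_parts [set: G] | k == #|P|) f k).
  apply: eq_bigr => k _; rewrite mulnC -sum_nat_const.
  by apply: eq_bigl => P; rewrite !inE -andbA [k == _]eq_sym.
rewrite (exchange_big_dep [in stable_parts [set: G]]) /=; last first.
  by move=> k P _ /andP[].
apply: eq_bigr => P PS; under eq_bigl do rewrite PS.
move: PS; rewrite inE => /andP[PT _].
rewrite big_nat1_eq (card_partition_gt0 PT (in_setT x)) ltnS.
by have := card_partition_leq PT; rewrite cardsT => ->.
Qed.

Lemma calB_stable_parts (G : sgraph) (x : G) :
  calB G = \sum_(P in stable_parts [set: G]) 1.
Proof.
by rewrite -(sum_stable_parts x (fun=> 1)); apply: eq_bigr => k _; rewrite mul1n.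
Qed.

Lemma calT_stable_parts (G : sgraph) (x : G) :
  calT G = \sum_(P in stable_parts [set: G]) #|P|.
Proof. by rewrite -(sum_stable_parts x id). Qed.

Lemma calB_gt0 (G : sgraph) (x : G) : 0 < calB G.
Proof.
rewrite (calB_stable_parts x) sum1_card card_gt0; apply/set0Pn.
(* The partition into singletons is always stable. *)
exists (preim_partition id [set: G]); rewrite inE preim_partitionP.
apply/forall_inP=> A /imsetP[y _ ->]; apply/stableP=> a b.
by rewrite !inE /= => /eqP <- /eqP <-; rewrite adj_irr.
Qed.

(** * Joining an isolated vertex to another vertex *)

Section AddEdge.
Variables (G : sgraph) (u v : G).
Hypothesis neq_uv : u != v.

Definition add_edge_adj : rel G := fun x y =>
  [|| adj x y, (x == u) && (y == v) | (x == v) && (y == u)].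

Lemma add_edge_adj_sym : symmetric add_edge_adj.
Proof.
move=> x y; rewrite /add_edge_adj adj_sym; congr orb.
by rewrite orbC andbC [(x == u) && _]andbC.
Qed.

Lemma add_edge_adj_irr : irreflexive add_edge_adj.
Proof.
move=> x; rewrite /add_edge_adj adj_irr /=.
by case: (eqVneq x u) => [->|_]; rewrite ?(negPf neq_uv) ?andbF.
Qed.

Definition add_edge : sgraph := SGraph add_edge_adj_sym add_edge_adj_irr.

(** Both graphs have the same vertex type, so [P] can be read in either; the new edge only forbids
    [u] and [v] from sharing a block. *)
Lemma stable_parts_add_edge (P : {set {set G}}) :
  (P \in @stable_parts add_edge [set: add_edge]) =
  (P \in stable_parts [set: G]) && (v \notin pblock P u).
Proof.
rewrite !inE -andbA; case PT: (partition P [set: G]) => //=.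
have tP := partition_trivIset PT; have cP := cover_partition PT.
apply/forall_inP/andP=> [h|[/forall_inP h vu] A AP].
  split.
    apply/forall_inP=> A /h/(@stableP add_edge) st.
    apply/stableP=> x y xA yA; have := st x y xA yA.
    by rewrite /= /add_edge_adj negb_or => /andP[].
  apply/negP=> vu; have uc : u \in cover P by rewrite cP inE.
  have /h/(@stableP add_edge)/(_ u v) := pblock_mem uc.
  rewrite mem_pblock uc vu => /(_ isT isT).
  by rewrite /= /add_edge_adj !eqxx orbT.
have nuv : ~ (u \in A /\ v \in A).
  by case=> uA; rewrite -(def_pblock tP AP uA) (negPf vu).
apply/(@stableP add_edge)=> x y xA yA; rewrite /= /add_edge_adj.
rewrite (negPf (stableP _ (h A AP) x y xA yA)) /=.
by apply/negP=> /orP[]/andP[/eqP ex /eqP ey]; apply: nuv; rewrite -ex -ey.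
Qed.

Hypothesis iso_u : isolated u.

(** The first summand counts [u] as a new block, the second its insertion into any of the blocks of
    [Q]. *)
Lemma sum_stable_parts_isolated (f : nat -> nat) :
  \sum_(P in stable_parts [set: G]) f #|P| =
  \sum_(Q in stable_parts [set~ u]) (f #|Q|.+1 + #|Q| * f #|Q|).
Proof.
have := sum_stable_parts_insert xpredT f iso_u.
under eq_bigl do rewrite andbT; move=> ->.
apply: eq_bigr => Q; rewrite inE => /andP[QD _].
under eq_bigl do rewrite andbT.
rewrite big_setU1 ?(partition0 QD) //= eqxx addn1; congr addn.
rewrite -sum_nat_const; apply: eq_bigr => A AQ.
by rewrite (negPf (partition_neq0 QD AQ)) addn0.
Qed.

(** Compared with [G], exactly one insertion is lost, that into the block of [v]; hence the
    predecessor. *)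
Lemma sum_stable_parts_add_edge (f : nat -> nat) :
  \sum_(P in @stable_parts add_edge [set: add_edge]) f #|P| =
  \sum_(Q in stable_parts [set~ u]) (f #|Q|.+1 + #|Q|.-1 * f #|Q|).
Proof.
under eq_bigl do rewrite stable_parts_add_edge.
rewrite (sum_stable_parts_insert (fun A => v \notin A) f iso_u).
apply: eq_bigr => Q; rewrite inE => /andP[QD _].
have vQ : v \in [set~ u] by rewrite !inE eq_sym.
have cQ := cover_partition QD; have tQ := partition_trivIset QD.
have BQ : pblock Q v \in Q by rewrite pblock_mem ?cQ.
rewrite big_mkcondr big_setU1 ?(partition0 QD) //= eqxx addn1.
rewrite !inE orbF eq_sym neq_uv; congr addn.
have -> : #|Q|.-1 = #|Q :\ pblock Q v| by rewrite (cardsD1 (pblock Q v)) BQ.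
rewrite -sum_nat_const (bigD1 _ BQ) /=.
rewrite !inE eq_sym (negPf neq_uv) mem_pblock cQ vQ add0n.
apply: eq_big => [A|A /andP[AQ nA]]; first by rewrite !inE andbC.
rewrite (negPf (partition_neq0 QD AQ)) addn0 !inE eq_sym (negPf neq_uv) /=.
by case: ifP => // /negbFE vA; rewrite -(def_pblock tQ AQ vA) eqxx in nA.
Qed.

End AddEdge.

(** * Cauchy-Schwarz and the strict increase of the average *)

Lemma sum_sqr_leq (I : finType) (A : {set I}) (f : I -> nat) :
  (\sum_(i in A) f i) ^ 2 <= #|A| * \sum_(i in A) f i ^ 2.
Proof.
have -> : #|A| * (\sum_(i in A) f i ^ 2) = \sum_(i in A) \sum_(j in A) f j ^ 2.
  by rewrite sum_nat_const.
rewrite -(leq_pmul2l (isT : 0 < 2)) -mulnn big_distrlr /=.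
(* Of the two copies of the double sum on the right, one is transposed, which leaves
   [2 * (a * b) <= a ^ 2 + b ^ 2] for each pair of indices. *)
rewrite [leqRHS]mul2n -addnn [X in X + _]exchange_big /= -big_split big_distrr.
rewrite leq_sum //= => i _; rewrite -big_split big_distrr leq_sum //= => j _.
by rewrite nat_Cauchy.
Qed.

(* Both averages are expressed through the numbers [k] of blocks of the stable
   partitions of [G - u]: with [b], [t], [s] the sums of [1], [k], [k ^ 2],
   they are [(s + t + b) / (t + b)] and [(s + b) / t], and these compare as
   [t ^ 2 < s * b + b ^ 2], which follows from Cauchy-Schwarz. *)
Lemma calA_add_edge (G : sgraph) (u v : G) (neq_uv : u != v) :
  isolated u -> (calA G < calA (add_edge neq_uv))%R.
Proof.
move=> iu; have B0 := calB_gt0 u; have B'0 := @calB_gt0 (add_edge neq_uv) u.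
rewrite /calA ltr_pdivrMr ?ltr0n // mulrAC.
rewrite ltr_pdivlMr ?ltr0n // -!natrM.
rewrite ltr_nat; move: B'0.
rewrite (calB_stable_parts u) (calT_stable_parts u).
rewrite (@calB_stable_parts (add_edge neq_uv) u).
rewrite (@calT_stable_parts (add_edge neq_uv) u).
rewrite (sum_stable_parts_isolated iu (fun=> 1)).
rewrite (sum_stable_parts_isolated iu id).
rewrite (sum_stable_parts_add_edge neq_uv iu (fun=> 1)).
rewrite (sum_stable_parts_add_edge neq_uv iu id).
set S := stable_parts _; set t := \sum_(Q in S) #|Q|.
set s := \sum_(Q in S) #|Q| ^ 2.
(* Every [Q] has a block containing [v], so the truncated predecessor [#|Q|.-1] is a true
   subtraction below. *)
have pos Q : Q \in S -> 0 < #|Q|.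
  rewrite inE => /andP[QD _]; apply: (card_partition_gt0 (x := v) QD).
  by rewrite !inE eq_sym.
have -> : \sum_(Q in S) (1 + #|Q|.-1 * 1) = t.
  by apply: eq_bigr => Q /pos; lia.
have -> : \sum_(Q in S) (1 + #|Q| * 1) = #|S| + t.
  by rewrite big_split sum1_card; congr addn; apply: eq_bigr => Q _; lia.
have -> : \sum_(Q in S) (#|Q|.+1 + #|Q| * #|Q|) = #|S| + t + s.
  by rewrite -sum1_card -!big_split; apply: eq_bigr => Q _ /=; lia.
have -> : \sum_(Q in S) (#|Q|.+1 + #|Q|.-1 * #|Q|) = #|S| + s.
  rewrite -sum1_card -!big_split; apply: eq_bigr => Q /pos /=.
  by case: #|Q| => // k _; lia.
have := sum_sqr_leq S (fun Q => #|Q|); rewrite -/t -/s => CS t0.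
(* Strictness comes from the term [#|S| ^ 2]. That [S] is nonempty follows from [0 < t], the
   positivity of [calB] for the enlarged graph. *)
have b0 : 0 < #|S|.
  rewrite card_gt0; apply: contraTneq t0 => S0.
  by rewrite /t S0 big_set0.
nia.
Qed.

(** * Invariance under isomorphism *)

Lemma isomorphic_sym (G H : sgraph) : isomorphic G H -> isomorphic H G.
Proof.
case=> f [g fK gK] fadj; exists g; first by exists f.
by move=> x y; rewrite -fadj !gK.
Qed.

(** Taking images of blocks is injective on stable partitions. Symmetry of isomorphism then upgrades
    the inequality to an equality. *)
Lemma isomorphic_nb_colorings_leq (G H : sgraph) (k : nat) :
  isomorphic G H -> nb_colorings G k <= nb_colorings H k.
Proof.
case=> f [g fK gK] fadj; have f_inj := can_inj fK.
pose F (P : {set {set G}}) : {set {set H}} := [set f @: A | A : {set G} in P].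
have F_inj : injective F by apply/imset_inj/imset_inj.
rewrite /nb_colorings -(card_imset _ F_inj) subset_leq_card //.
apply/subsetP=> _ /imsetP[P + ->]; rewrite !inE => /and3P[PT /forall_inP st kP].
apply/and3P; split.
- have -> : [set: H] = f @: [set: G].
    by apply/setP=> y; rewrite inE -(gK y) imset_f.
  by rewrite imset_partition.
- apply/forall_inP=> _ /imsetP[A AP ->]; apply/stableP=> a b.
  move=> /imsetP[x xA ->] /imsetP[y yA ->]; rewrite fadj.
  exact: (stableP _ (st A AP)).
- by rewrite card_imset //; apply: imset_inj.
Qed.

Lemma isomorphic_calA (G H : sgraph) : isomorphic G H -> calA G = calA H.
Proof.
move=> GH; have HG := isomorphic_sym GH.
have cGH : #|G| = #|H| by case: GH => f bf _; apply: bij_eq_card bf.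
have nGH k : nb_colorings G k = nb_colorings H k.
  by apply/eqP; rewrite eqn_leq !isomorphic_nb_colorings_leq.
rewrite /calA /calT /calB cGH.
by congr (_%:R / _%:R)%R; apply: eq_bigr => k _; rewrite nGH.
Qed.

(** * Graphs with at most one neighbor per vertex, seen as involutions *)

Section Matching.
Variable G : sgraph.
Hypothesis adj_fun : forall x y z : G, adj x y -> adj x z -> y = z.

(** The default value [x] makes the isolated vertices the fixed points, so that [mate] is a total
    involution encoding the whole graph. *)
Definition mate (x : G) : G := odflt x [pick y | adj x y].

Lemma adjE (x y : G) : adj x y = (y == mate x) && (mate x != x).
Proof.
rewrite /mate; case: pickP => [z xz|nx] /=.
  have -> : z != x by apply: contraTneq xz => ->; rewrite adj_irr.
  by rewrite andbT; apply/idP/eqP=> [xy|->//]; apply: adj_fun xy xz.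
by rewrite nx eqxx andbF.
Qed.

Lemma isolatedE (x : G) : isolated x = (mate x == x).
Proof.
apply/forallP/idP => [/(_ (mate x))|/eqP mx y]; rewrite adjE ?mx ?eqxx ?andbF //.
by rewrite negbK.
Qed.

Lemma mateK : involutive mate.
Proof.
move=> x; have [mx|mx] := eqVneq (mate x) x; first by rewrite !mx.
have : adj (mate x) x by rewrite adj_sym adjE eqxx.
by rewrite adjE => /andP[/eqP <-].
Qed.

(** The enumeration order selects one endpoint of each edge, so this set indexes the edges. *)
Definition lower_ends : {set G} := [set x | enum_rank x < enum_rank (mate x)].
Definition isolated_vertices : {set G} := [set x : G | isolated x].

Local Notation L := lower_ends.
Local Notation Q := isolated_vertices.

Lemma mate_L (x : G) : x \in L -> mate x \notin L.
Proof. by rewrite !inE mateK -leqNgt => /ltnW. Qed.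

Lemma mate_neq_L (x : G) : x \in L -> mate x != x.
Proof. by move=> xL; apply: contraTneq xL => mx; rewrite inE mx ltnn. Qed.

(** The vertices split into the lower ends, their mates and the isolated vertices. *)
Lemma card_matching : #|G| = #|L| * 2 + #|Q|.
Proof.
have <- : #|L :|: mate @: L :|: Q| = #|G|.
  rewrite -cardsT; congr #|pred_of_set _|; apply/setP=> x; rewrite !inE isolatedE.
  rewrite -[x in x \in _ @: _]mateK (mem_imset _ _ (inv_inj mateK)) inE mateK.
  by rewrite -(inj_eq enum_rank_inj) -(inj_eq val_inj) /=; case: ltngtP.
rewrite !cardsU card_imset; last exact: inv_inj mateK.
have -> : L :&: mate @: L = set0.
  apply/setP=> x; rewrite !inE; apply/andP=> -[xL /imsetP[y yL xy]].
  by have := mate_L yL; rewrite -xy inE xL.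
have -> : (L :|: mate @: L) :&: Q = set0.
  apply/setP=> x; rewrite !inE isolatedE; apply/andP=> -[xL mx].
  case/orP: xL => [|/imsetP[y yL xy]]; first by rewrite (eqP mx) ltnn.
  by move: mx; rewrite xy mateK eq_sym (negPf (mate_neq_L yL)).
by rewrite cards0 !subn0 muln2 addnn.
Qed.

(** With at most one isolated vertex, [card_matching] is the Euclidean division of the order by 2:
    the quotient counts the edges and the remainder the isolated vertices. *)
Lemma few_isolated_isomorphic : #|Q| <= 1 ->
  isomorphic (dunion (copies (#|G| %/ 2) (complete_graph 2))
                     (copies (#|G| %% 2) (complete_graph 1))) G.
Proof.
move=> Q1.
have dG : #|G| %/ 2 = #|L| by rewrite card_matching; lia.
have mG : #|G| %% 2 = #|Q| by rewrite card_matching; lia.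
rewrite dG mG; set H := dunion _ _.
(* Copy [i] of the complete graph on two vertices goes to the [i]-th edge, with [ord0] sent to its
   lower end; the single vertices enumerate the isolated ones. *)
pose g (a : H) : G :=
  match a with
  | inl (i, b) => if b == ord0 then enum_val i else mate (enum_val i)
  | inr (i, _) => enum_val i
  end.
have lL (i : 'I_#|L|) : enum_val i \in L by apply: enum_valP.
have mQ (i : 'I_#|Q|) : mate (enum_val i) = enum_val i.
  by apply/eqP; rewrite -isolatedE; have := enum_valP i; rewrite inE.
have ord2 (b c : 'I_2) : (b == ord0) = (c == ord0) -> b = c.
  by case: b c => [[|[|//]] ?] [[|[|//]] ?] //= _; apply: val_inj.
(* Being moved or fixed by [mate] separates the images of the two sides of the union. *)
have ginl i b : mate (g (inl (i, b))) != g (inl (i, b)).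
  by rewrite /=; case: ifP => _; last rewrite mateK eq_sym; apply: mate_neq_L.
have ginr i b : mate (g (inr (i, b))) = g (inr (i, b)) by apply: mQ.
have g_inj : injective g.
  move=> [[i b]|[i b]] [[j c]|[j c]] gab.
  - suff [-> bc] : i = j /\ (b == ord0) = (c == ord0) by rewrite (ord2 b c).
    move: gab => /=; case: ifP => _; case: ifP => _.
    + by move/enum_val_inj.
    + by move=> E; have := mate_L (lL j); rewrite -E lL.
    + by move=> E; have := mate_L (lL i); rewrite E lL.
    + by move/(inv_inj mateK)/enum_val_inj.
  - by have := ginl i b; rewrite gab ginr eqxx.
  - by have := ginl j c; rewrite -gab ginr eqxx.
  - by move: gab => /= /enum_val_inj ->; rewrite !ord1.
exists g.
  apply: inj_card_bij => //.
  by rewrite card_sum !card_prod !card_ord muln1 -card_matching.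
move=> [[i b]|[i b]] [[j c]|[j c]]; rewrite adjE.
- rewrite ginl andbT /= /copies_adj /= /complete_adj.
  have [-> /=|nij /=] := eqVneq i j.
    case: (eqVneq b c) => [->|nbc] /=.
      by apply/negbTE; rewrite eq_sym; apply: ginl.
    have : (b == ord0) != (c == ord0) by apply: contra_neq nbc => /ord2.
    by case: ifP; case: ifP => //; rewrite ?mateK eqxx.
  apply/negbTE; apply: contra_neq nij.
  case: ifP => _; case: ifP => _ /=; rewrite ?mateK => E.
  + by have := mate_L (lL i); rewrite -E lL.
  + by move/enum_val_inj: E.
  + by move/(inv_inj mateK)/enum_val_inj: E.
  + by have := mate_L (lL j); rewrite E lL.
- apply/negbTE; rewrite ginl andbT; apply: contraNneq (ginl i b) => E.
  by rewrite -(inj_eq (inv_inj mateK)) -E ginr.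
- by rewrite ginr eqxx andbF.
- rewrite ginr eqxx andbF /= /copies_adj /= /complete_adj.
  by rewrite [b]ord1 [c]ord1 eqxx andbF.
Qed.

End Matching.

(** * Adding edges until at most one isolated vertex is left *)

Lemma max_degree1_matching (G : sgraph) : max_degree G = 1 ->
  forall x y z : G, adj x y -> adj x z -> y = z.
Proof.
move=> D1 x y z xy xz.
have : degree x <= 1 by rewrite -D1; apply: leq_bigmax.
by move/card_le1_eqP; apply; rewrite inE.
Qed.

Lemma add_edge_matching (G : sgraph) (u v : G) (neq_uv : u != v) :
  (forall x y z : G, adj x y -> adj x z -> y = z) ->
  isolated u -> isolated v ->
  forall x y z : add_edge neq_uv, adj x y -> adj x z -> y = z.
Proof.
move=> mG /forallP iu /forallP iv x y z; rewrite /= /add_edge_adj.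
have [->|xu] := eqVneq x u.
  by rewrite !(negPf (iu _)) (negPf neq_uv) !orbF /= => /eqP-> /eqP->.
have [->|xv] /= := eqVneq x v.
  by rewrite !(negPf (iv _)) /= => /eqP-> /eqP->.
rewrite !orbF; exact: mG.
Qed.

Lemma isolated_vertices_add_edge (G : sgraph) (u v : G) (neq_uv : u != v) :
  isolated u ->
  #|isolated_vertices (add_edge neq_uv)| < #|isolated_vertices G|.
Proof.
move=> iu; apply/proper_card/properP; split.
  apply/subsetP=> x; rewrite !inE => /forallP ix; apply/forallP=> y.
  by have := ix y; rewrite /= /add_edge_adj negb_or => /andP[].
exists u; rewrite inE //; apply/negP=> /forallP/(_ v).
by rewrite /= /add_edge_adj !eqxx orbT.
Qed.

(** Induction on the number of isolated vertices: two of them can be joined, which keeps the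
    matching property and strictly increases [calA]. The target [H] depends only on the order, so it
    does not change. *)
Lemma matching_calA_max (G : sgraph) :
  (forall x y z : G, adj x y -> adj x z -> y = z) ->
  let H := dunion (copies (#|G| %/ 2) (complete_graph 2))
                  (copies (#|G| %% 2) (complete_graph 1)) in
  (calA G < calA H)%R \/ isomorphic G H.
Proof.
have [m] := ubnP #|isolated_vertices G|; elim: m G => // m IHm G ltGm mG H.
have [/(few_isolated_isomorphic mG)/isomorphic_sym|/card_gt1P] :=
  leqP #|isolated_vertices G| 1; first by right.
case=> u [v [/[!inE] iu iv neq_uv]]; left.
apply: (lt_le_trans (calA_add_edge neq_uv iu)).
(* The first added edge already gives strictness, so a weak inequality suffices for the enlarged
   graph in both alternatives. *)
have [||/ltW //|/isomorphic_calA ->] := IHm (add_edge neq_uv).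
- by rewrite -ltnS (leq_trans _ ltGm) // ltnS isolated_vertices_add_edge.
- exact: add_edge_matching.
- exact: lexx.
Qed.

Theorem theorem13 (G : sgraph) (n : nat) (order_G : #|G| = n)
    (Delta_G : max_degree G = 1) :
  let H := dunion (copies (n %/ 2) (complete_graph 2))
                  (copies (n %% 2) (complete_graph 1)) in
  (calA G <= calA H)%R /\ (calA G = calA H <-> isomorphic G H).
Proof.
move=> H; have [ltGH|isoGH] : (calA G < calA H)%R \/ isomorphic G H.
- by rewrite /H -order_G; apply/matching_calA_max/max_degree1_matching.
- split; first exact: ltW.
  split=> [eqGH|/isomorphic_calA//].
  by rewrite eqGH ltxx in ltGH.
- by rewrite (isomorphic_calA isoGH).
Qed.
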